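(* Let $f:X\to Y$ be a perfect map between zero-dimensional locally compact Hausdorff spaces, let $B=CO(Y)$, $J=CK(Y)$, $A=CO(X)$, and let $\varphi=\Theta^t(f):B\to A$ be given by $\varphi(G)=f^{-1}(G)$. Then the following are equivalent: $f$ is a surjection; $\varphi$ is an injection; the restriction $\varphi|_J$ is an injection.
   Context: A space is zero-dimensional if its clopen subsets form a base. $CO(X)$ is the Boolean algebra of clopen subsets of $X$ and $CK(X)$ is the set of compact clopen subsets of $X$. A perfect map is a continuous closed map with compact fibres. *)

(* Defs.v *)
From HB Require Import structures.
From mathcomp Require Import all_boot all_order.
From mathcomp Require Import boolp classical_sets functions topology.

Set Implicit Arguments.
Unset Strict Implicit.
Unset Printing Implicit Defensive.
Import Order.TTheory.
Local Open Scope classical_set_scope.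

(* The library's [zero_dimensional] only asks that clopen sets separate points,
   which is weaker in general than their forming a base. *)
Definition has_clopen_base (T : topologicalType) : Prop :=
  basis [set U : set T | clopen U].

(* Surjectivity is not required. *)
Record perfect_map (X Y : topologicalType) (f : X -> Y) : Prop := PerfectMap {
  perfect_continuous : continuous f;
  perfect_closed : forall C : set X, closed C -> closed (f @` C);
  perfect_fibre : forall y : Y, compact (f @^-1` [set y])
}.

(* Membership is boolean (through [asbool]) so that CO T is a subType of
   set T: two elements are equal iff their underlying sets are. *)
Record CO (T : topologicalType) : Type := ClopenSet {
  clopen_set :> set T;
  clopen_setP : clopen_set \in [set U : set T | clopen U]
}.

Lemma CO_clopen (T : topologicalType) (G : CO T) : clopen (clopen_set G).
Proof. exact: (set_mem (clopen_setP G)). Qed.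

Definition CK (T : topologicalType) : set (CO T) :=
  [set G | compact (clopen_set G)].
Arguments CK T : clear implicits.

Section BooleanAlgebra.
Variable T : topologicalType.

HB.instance Definition _ := [isSub for @clopen_set T].
HB.instance Definition _ := [Choice of CO T by <:].

Lemma clopen_set_inj : injective (@clopen_set T).
Proof. exact: val_inj. Qed.

Fact clopen_meet_closed :
  meet_closed (mem [set U : set T | clopen U]).
Proof. by move=> A B /set_mem cA /set_mem cB; apply/mem_set/clopenI. Qed.

Fact clopen_join_closed :
  join_closed (mem [set U : set T | clopen U]).
Proof. by move=> A B /set_mem cA /set_mem cB; apply/mem_set/clopenU. Qed.

Fact clopen_bottom : (\bot%O : set T) \in [set U : set T | clopen U].
Proof. exact/mem_set/clopen0. Qed.

Fact clopen_top : (\top%O : set T) \in [set U : set T | clopen U].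
Proof. exact/mem_set/clopenT. Qed.

HB.instance Definition _ :=
  Order.SubChoice_isTBSubLattice.Build set_display (set T) _ set_display (CO T)
    clopen_meet_closed clopen_join_closed clopen_bottom clopen_top.

Lemma clopen_setI (A B : CO T) :
  clopen_set (Order.meet A B) = clopen_set A `&` clopen_set B.
Proof. exact: (@Order.valI_subproof _ _ _ _ (CO T) A B). Qed.

Lemma clopen_setU (A B : CO T) :
  clopen_set (Order.join A B) = clopen_set A `|` clopen_set B.
Proof. exact: (@Order.valU_subproof _ _ _ _ (CO T) A B). Qed.

Lemma clopen_set_bottom : clopen_set (\bot%O : CO T) = set0.
Proof. exact: (@Order.val0_subproof _ _ _ _ (CO T)). Qed.

Lemma clopen_set_top : clopen_set (\top%O : CO T) = [set: T].
Proof. exact: (@Order.val1_subproof _ _ _ _ (CO T)). Qed.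

Fact CO_meetUl : left_distributive (@Order.meet _ (CO T)) (@Order.join _ (CO T)).
Proof.
move=> A B C; apply: clopen_set_inj.
by rewrite !(clopen_setI, clopen_setU) setIUl.
Qed.

HB.instance Definition _ :=
  Order.Lattice_Meet_isDistrLattice.Build set_display (CO T) CO_meetUl.

Definition CO_compl (G : CO T) : CO T :=
  ClopenSet (mem_set (clopenC (clopen_set G) (CO_clopen G))).

Fact CO_joinxC (G : CO T) : Order.join G (CO_compl G) = \top%O.
Proof.
by apply: clopen_set_inj; rewrite clopen_setU clopen_set_top; exact: setUv.
Qed.

Fact CO_meetxC (G : CO T) : Order.meet G (CO_compl G) = \bot%O.
Proof.
by apply: clopen_set_inj; rewrite clopen_setI clopen_set_bottom; exact: setICr.
Qed.

HB.instance Definition _ :=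
  Order.TBDistrLattice_hasComplement.Build set_display (CO T)
    CO_joinxC CO_meetxC.

End BooleanAlgebra.

Definition Theta_t (X Y : topologicalType) (f : X -> Y) (pf : perfect_map f)
    (G : CO Y) : CO X :=
  ClopenSet (mem_set (preimage_clopen (CO_clopen G) (perfect_continuous pf))).

Section ThetaMorphism.
Context {X Y : topologicalType} {f : X -> Y} (pf : perfect_map f).

Lemma clopen_set_Theta_t (G : CO Y) :
  clopen_set (Theta_t pf G) = f @^-1` clopen_set G.
Proof. by []. Qed.

Fact Theta_t_meet : Order.meet_morphism (Theta_t pf).
Proof.
by move=> G H; apply: clopen_set_inj; rewrite !(clopen_set_Theta_t, clopen_setI).
Qed.

Fact Theta_t_join : Order.join_morphism (Theta_t pf).
Proof.
by move=> G H; apply: clopen_set_inj; rewrite !(clopen_set_Theta_t, clopen_setU).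
Qed.

Fact Theta_t_bottom : Theta_t pf \bot%O = \bot%O.
Proof.
apply: clopen_set_inj; rewrite !(clopen_set_Theta_t, clopen_set_bottom).
exact: preimage_set0.
Qed.

Fact Theta_t_top : Theta_t pf \top%O = \top%O.
Proof.
apply: clopen_set_inj; rewrite !(clopen_set_Theta_t, clopen_set_top).
exact: preimage_setT.
Qed.

Fact Theta_t_homo : {homo Theta_t pf : G H / (G <= H)%O}.
Proof.
by move=> G H /meet_idPl GH; apply/meet_idPl; rewrite -Theta_t_meet GH.
Qed.

HB.instance Definition _ :=
  Order.isOrderMorphism.Build _ (CO Y) _ (CO X) (Theta_t pf) Theta_t_homo.
HB.instance Definition _ :=
  Order.isLatticeMorphism.Build _ (CO Y) _ (CO X) (Theta_t pf)
    Theta_t_meet Theta_t_join.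
HB.instance Definition _ :=
  Order.isBLatticeMorphism.Build _ (CO Y) _ (CO X) (Theta_t pf) Theta_t_bottom.
HB.instance Definition _ :=
  Order.isTLatticeMorphism.Build _ (CO Y) _ (CO X) (Theta_t pf) Theta_t_top.

End ThetaMorphism.

(* Main.v *)
Require Import Defs.
From mathcomp Require Import all_boot all_order.
From mathcomp Require Import boolp classical_sets functions topology.
Local Open Scope classical_set_scope.

(** If [f] is onto, a set is the image of its preimage, so taking preimages is
injective, on all clopen sets and a fortiori on the compact ones.

Conversely, a perfect map has closed range, so a point [y] missed by [f] has a
neighbourhood missed by [f].  In a locally compact space with a clopen base,
that neighbourhood contains a compact clopen set [K] around [y]
([compact_clopen_nbhs]).  Then [K] and the empty set are distinct compact clopen
sets with the same (empty) preimage, so the preimage map is not injective on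
compact clopen sets. *)

(** Intersecting [U] with a compact neighbourhood of [y] before going down to the
clopen base makes the basic set [V] compact, as a closed subset of a compact
set. *)
Lemma compact_clopen_nbhs (Y : topologicalType) :
    locally_compact [set: Y] -> has_clopen_base Y ->
  forall (y : Y) (U : set Y), nbhs y U ->
  exists V : CO Y, [/\ CK Y V, clopen_set V y & clopen_set V `<=` U].
Proof.
move=> lcY [_ baseY] y U nyU.
have [K nyKT [cptK _]] := lcY y I.
have {}nyKT : nbhs y [set z | [set: Y] z -> K z] := nyKT.
have nyK : nbhs y K by apply: filterS nyKT => z; apply.
have [V [clopenV Vy] subV] := baseY y (U `&` K) (filterI nyU nyK).
exists (ClopenSet (mem_set clopenV)); split=> //=.
- by apply: (subclosed_compact clopenV.2 cptK) => z /subV[].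
- by move=> z /subV[].
Qed.

Theorem theorem3p13 (X Y : topologicalType)
    (hausX : hausdorff_space X) (hausY : hausdorff_space Y)
    (lcX : locally_compact [set: X]) (lcY : locally_compact [set: Y])
    (zdX : has_clopen_base X) (zdY : has_clopen_base Y)
    (f : X -> Y) (pf : perfect_map f) :
  [<-> set_surj [set: X] [set: Y] f;
       injective (Theta_t pf);
       set_inj (CK Y) (Theta_t pf)].
Proof.
tfae.
- move=> surjf G H eqGH; apply: clopen_set_inj.
  have {}eqGH : f @^-1` clopen_set G = f @^-1` clopen_set H :=
    congr1 (@clopen_set X) eqGH.
  have imf : f @` setT = setT by apply/seteqP; split.
  by rewrite -(image_preimage (clopen_set G) imf) eqGH image_preimage.
- by move=> injT G H _ _; exact: injT.
- move=> injT y _; apply: contrapT => fy.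
  have clf : closed (range f) by exact: (perfect_closed pf closedT).
  have nfy : nbhs y (~` range f).
    by apply: open_nbhs_nbhs; split; [exact: closed_openC | exact: fy].
  have [K [cptK Ky Kf]] := compact_clopen_nbhs _ lcY zdY _ _ nfy.
  have cpt0 : compact (clopen_set (\bot%O : CO Y)).
    by rewrite clopen_set_bottom; exact: compact0.
  have K0 : K = \bot%O.
    apply: injT; [exact: mem_set | exact: mem_set |].
    rewrite Theta_t_bottom; apply: clopen_set_inj; rewrite clopen_set_bottom.
    by apply: preimage0 => z [/Kf].
  by move: Ky; rewrite K0 clopen_set_bottom.
Qed.
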